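(* Let $N, L, n$ be integers with $1 \le n \le N$, $n - 1 \le N/2$ and $L \in \{0,1,\ldots,N\}$. Then \[ \rho \bigl( \mathrm{Hyp}(N,L,n), \mathrm{Bin}(n,L/N) \bigr) \ \le \ \rho \bigl( \mathrm{Hyp}(N,1,n), \mathrm{Bin}(n,1/N) \bigr) \ = \ \Bigl( 1 - \frac{1}{N} \Bigr)^{-(n-1)} \ \le \ \Bigl( 1 - \frac{n-1}{N} \Bigr)^{-1} . \] Moreover, \[ d_{\mathrm{TV}} \bigl( \mathrm{Hyp}(N,L,n), \mathrm{Bin}(n,L/N) \bigr) \ \le \ \Bigl( 1 - \frac{[L]_n}{[N]_n} - \frac{[N-L]_n}{[N]_n} \Bigr) \Bigl( 1 - \Bigl(1 - \frac{1}{N}\Bigr)^{n-1} \Bigr) \ \le \ \Bigl( 1 - \frac{[L]_n}{[N]_n} - \frac{[N-L]_n}{[N]_n} \Bigr) \frac{n-1}{N} . \]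
   Context: $\mathrm{Hyp}(N,L,n)$ is the hypergeometric distribution: the law of the number of black balls among $n$ balls drawn without replacement from an urn with $N$ balls of which $L$ are black; its weights are $\binom{L}{k}\binom{N-L}{n-k}/\binom{N}{n}$. $\mathrm{Bin}(n,p)$ is the binomial distribution. For real $a$ and integers $m \ge 1$, $[a]_m := \prod_{i=0}^{m-1}(a-i)$, $[a]_0 := 1$. For probability measures $Q,P$ on $(\mathcal{X},\mathcal{A})$: $\rho(Q,P) := \sup_{A \in \mathcal{A}} Q(A)/P(A)$ with conventions $0/0 := 0$, $a/0 := \infty$ for $a>0$; and $d_{\mathrm{TV}}(Q,P) := \sup_{A \in \mathcal{A}} |Q(A) - P(A)|$. *)

(* Defs.v *)
From HB Require Import structures.
From mathcomp Require Import all_boot all_order all_algebra.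
From mathcomp Require Import reals constructive_ereal.

Import Order.TTheory GRing.Theory Num.Theory.
Local Open Scope ring_scope.

(* Distributions on the sample space {0,...,n}, modelled as 'I_n.+1,
   with sigma-algebra the full power set {set 'I_n.+1}. *)

Definition ffact {R : pzRingType} (a : R) (m : nat) : R :=
  \prod_(i < m) (a - i%:R).

Definition hyp {R : realType} (N L n : nat) (k : 'I_n.+1) : R :=
  ('C(L, k))%:R * ('C(N - L, n - k))%:R / ('C(N, n))%:R.

Definition bin {R : realType} (n : nat) (p : R) (k : 'I_n.+1) : R :=
  ('C(n, k))%:R * p ^+ k * (1 - p) ^+ (n - k).

Definition prob {R : realType} {n : nat} (Q : 'I_n.+1 -> R)
  (A : {set 'I_n.+1}) : R := \sum_(k in A) Q k.

Definition ratio {R : realType} {n : nat} (Q P : 'I_n.+1 -> R)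
  (A : {set 'I_n.+1}) : \bar R :=
  if prob P A == 0 then (if prob Q A == 0 then 0%E else +oo%E)
  else (prob Q A / prob P A)%:E.

(* rho(Q,P) = sup_A Q(A)/P(A); the sup over the finite power set is a max
   (all ratios are >= 0, and A = set0 gives 0). *)
Definition rho {R : realType} {n : nat} (Q P : 'I_n.+1 -> R) : \bar R :=
  \big[Order.max/0%E]_(A : {set 'I_n.+1}) ratio Q P A.

Definition dTV {R : realType} {n : nat} (Q P : 'I_n.+1 -> R) : R :=
  \big[Num.max/0]_(A : {set 'I_n.+1}) `|prob Q A - prob P A|.

(* Main.v *)
Require Import Defs.
From HB Require Import structures.
From mathcomp Require Import all_boot all_order all_algebra.
From mathcomp Require Import reals constructive_ereal sequences exp.
From mathcomp Require Import ring lra zify.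
Import Order.TTheory GRing.Theory Num.Theory.
Local Open Scope ring_scope.

(* Everything follows from the pointwise bound r * Hyp(k) <= Bin(k), where
   r = (1 - 1/N)^(n-1), which is an equality for L = k = 1.  It gives the bound
   on rho at once; for d_TV one moreover uses Hyp <= Bin at k = 0 and k = n, so
   that Hyp(A) - Bin(A) <= (1 - r) * Hyp({1,...,n-1}) = (1 - r) * c.

   Write M = N - L, K = N - 1, k = a + 1, n - k = b + 1.  After clearing
   factorials the pointwise bound reads
     prod_{i<=a} (1 - i/L) * prod_{j<=b} (1 - j/M) <= prod_{i<=a+b} (1 - i/K).
   For a + b fixed the left side is largest when aM <= L(b+1) and
   bL <= M(a+1).  In that region n - 1 <= N/2 forces a <= L/2 and b <= M/2, the
   logarithm of the quotient is bounded below by an explicit rational function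
   (by induction on a + b, staying inside the region), and this function is
   nonnegative when a, b >= 1.  The cases a = 0 and b = 0 are elementary. *)

(** * Rational lower bound for the log-quotient *)

(* The first-order part D = sum i/L + sum j/M - sum i/K of the log-quotient,
   with l = L, m = M.  An increment d of D contributes at least
   d * K / (K - (a + b)) to the log-quotient; Abel summation turns the sum of
   these weighted increments into D * K / (K - (a + b)) minus an error which the
   last term dominates. *)
Definition log_gap {R : realFieldType} (l m a b : R) : R :=
  let K := l + m - 1 in
  (a * (a + 1) * K / (2 * l) + b * (b + 1) * K / (2 * m)
     - (a + b) * (a + b + 1) / 2) / (K - (a + b))
  - (a + b) * (a + b + 1) / (2 * (l + m) ^+ 2).

Lemma log_gapC (R : realFieldType) (l m a b : R) : log_gap l m a b = log_gap m l b a.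
Proof.
rewrite /log_gap [m + l]addrC [b + a]addrC; congr (_ / _ - _); congr (_ - _).
exact: addrC.
Qed.

(** The right-hand side is the [eta] with [1 - (a + 1) / l = (1 - (a + b + 1) / K) * (1 - eta)], so
    [1 - eta <= expR (- eta)] turns this into one induction step on the products. *)
Lemma log_gap_step (R : realFieldType) (l m a b : R) :
  0 < l -> 0 < m -> 0 <= a -> 0 <= b -> a * m <= l * (b + 1) ->
  b * l <= m * (a + 1) -> 2 * (a + b + 2) <= l + m ->
  log_gap l m (a + 1) b - log_gap l m a b
    <= ((a + 1) / l * (l + m - 1) - (a + b + 1)) / (l + m - 1 - (a + b + 1)).
Proof.
move=> l0 m0 a0 b0 h1 h2 h3.
pose K := l + m - 1.
have K1 : 0 < K - (a + b + 1) by rewrite /K; lra.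
have K2 : 0 < K - (a + b) by rewrite /K; lra.
have N0 : 0 < l + m by lra.
(* d := a m - b l satisfies -m <= d <= l, so that C, in the form CE, is bounded
   by dropping (d + m) (l - d) >= 0. *)
pose C := a * (a + 1) * K / (2 * l) + b * (b + 1) * K / (2 * m)
     - (a + b) * (a + b + 1) / 2.
have CE : C = (l * m * (a + b + 1) * (K - (a + b))
       - K * ((a * m - b * l + m) * (l - (a * m - b * l)))) / (2 * l * m * (l + m)).
  by rewrite /C /K; field; rewrite !lt0r_neq0.
have Cle : C <= (a + b + 1) * (K - (a + b)) / (2 * (l + m)).
  have -> : (a + b + 1) * (K - (a + b)) / (2 * (l + m)) =
    (l * m * (a + b + 1) * (K - (a + b))) / (2 * l * m * (l + m)).
    by field; rewrite !lt0r_neq0.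
  rewrite CE ler_pM2r ?invr_gt0 ?mulr_gt0 // gerBl.
  by apply: mulr_ge0; [rewrite /K; lra | apply: mulr_ge0; lra].
have -> : log_gap l m (a + 1) b - log_gap l m a b =
   ((a + 1) / l * (l + m - 1) - (a + b + 1)) / (l + m - 1 - (a + b + 1))
   + (C / ((K - (a + b + 1)) * (K - (a + b))) - (a + b + 1) / (l + m) ^+ 2).
  rewrite /log_gap /C /K; field.
  by rewrite !lt0r_neq0 //; move: K1 K2; rewrite /K; lra.
rewrite gerDl subr_le0.
apply: (@le_trans _ _ ((a + b + 1) * (K - (a + b)) / (2 * (l + m)) / ((K - (a + b + 1)) * (K - (a + b))))).
  by rewrite ler_pM2r // invr_gt0 mulr_gt0.
have -> : (a + b + 1) * (K - (a + b)) / (2 * (l + m)) / ((K - (a + b + 1)) * (K - (a + b))) = (a + b + 1) / (l + m) * (2 * (K - (a + b + 1)))^-1.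
  by field; rewrite !lt0r_neq0.
(* What remains is [l + m <= 2 * (K - (a + b + 1))], which is the last hypothesis; the correction
   term of [log_gap] is chosen so that its increment is exactly [(a + b + 1) / (l + m) ^+ 2]. *)
rewrite expr2 [(_ * (l + m))^-1]invfM mulrA ler_pM2l ?divr_gt0 //; last by lra.
by rewrite lef_pV2 ?posrE //; rewrite /K; lra.
Qed.

(** Over a common denominator the only possibly harmful term is [g * (m - l - g)]. If it is
    positive, then so is [g], and it is at most [(m - l) ^+ 2 / 4], hence at most
    [(m - 2) ^+ 2 / 4]. *)
Lemma log_gap_ge0 (R : realFieldType) (l m a b : R) :
  1 <= a -> 1 <= b -> 2 <= l -> 2 <= m ->
  2 * (a + b + 1) <= l + m -> 0 <= log_gap l m a b.
Proof.
wlog lm : l m a b / l <= m => [hw|] a1 b1 l2 m2 h.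
  case: (leP l m) => [|/ltW] lm; first exact: hw.
  by rewrite log_gapC; apply: hw => //; lra.
pose g := b * l - a * m.
pose N := l + m.
have K2 : 0 < N - 1 - (a + b) by rewrite /N; lra.
have -> : log_gap l m a b =
  (l * m * (a + b) * ((N - (a + b + 1)) ^+ 2 - N) - N * (N - 1) * (g * (m - l - g)))
   / (2 * l * m * N ^+ 2 * (N - 1 - (a + b))).
  rewrite /log_gap /N /g; field.
  by rewrite ?lt0r_neq0 //; move: K2; rewrite /N; lra.
apply: divr_ge0; last by rewrite ?mulr_ge0 ?exprn_ge0 // /N; lra.
rewrite subr_ge0.
have B : N * (N - 4) / 4 <= (N - (a + b + 1)) ^+ 2 - N.
  have : 0 <= (N - (a + b + 1) - N / 2) * (N - (a + b + 1) + N / 2).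
    by apply: mulr_ge0; rewrite /N; lra.
  by lra.
have B0 : 0 <= N * (N - 4) / 4 by rewrite divr_ge0 ?mulr_ge0 // /N; lra.
have N0 : 0 <= N * (N - 1) by rewrite mulr_ge0 // /N; lra.
have l0 : 0 <= l * m * (a + b) by rewrite ?mulr_ge0 //; lra.
case: (leP (g * (m - l - g)) 0) => e0.
  apply: (@le_trans _ _ 0); first by rewrite mulr_ge0_le0.
  by rewrite mulr_ge0 // (le_trans B0).
have g0 : 0 < g.
  rewrite ltNge; apply/negP => g0.
  by move: e0; rewrite ltNge mulr_le0_ge0 //; lra.
apply: (@le_trans _ _ (N * (N - 1) * ((m - 2) ^+ 2 / 4))).
  rewrite ler_wpM2l //.
  have := sqr_ge0 (m - l - 2 * g).
  have : 0 <= (l - 2) * (2 * m - l - 2) by rewrite mulr_ge0 //; lra.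
  by rewrite !expr2; lra.
(* Since [g > 0] means [a * m < b * l], one gets [l * (a + b) > a * (l + m) >= N]. *)
have lN : N <= l * (a + b).
  have : 0 <= (a - 1) * (l + m) by rewrite mulr_ge0 //; lra.
  by move: g0; rewrite /g /N; lra.
apply: (@le_trans _ _ (m * N * (N * (N - 4) / 4))); last first.
  apply: ler_pM => //; first by rewrite mulr_ge0 // /N; lra.
  by rewrite [l * m]mulrC -mulrA ler_wpM2l //; lra.
have -> : m * N * (N * (N - 4) / 4) = N * N * (m * (N - 4) / 4) by ring.
apply: ler_pM => //.
- by rewrite divr_ge0 ?sqr_ge0.
- by rewrite ler_wpM2l // /N; lra.
- rewrite ler_pM2r ?invr_gt0 // expr2 /N.
  by apply: ler_pM; lra.
Qed.

(** * Products of [1 - i/l] and their exponential comparison *)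

(** The factors start at [i = 1]: for nonzero [l], [l ^+ a * qprod l a] is the falling factorial of
    [l - 1] of length [a]. *)
Definition qprod {R : realFieldType} (l : R) (a : nat) : R :=
  \prod_(i < a) (1 - i.+1%:R / l).

Lemma qprodS (R : realFieldType) (l : R) a :
  qprod l a.+1 = qprod l a * (1 - a.+1%:R / l).
Proof. by rewrite /qprod big_ord_recr. Qed.

Lemma qprod_ge0 (R : realFieldType) (l : R) (a : nat) : a%:R <= l -> 0 <= qprod l a.
Proof.
move=> h; apply: prodr_ge0 => -[i ia] _ /=.
have l0 : 0 < l by apply: lt_le_trans h; rewrite ltr0n; lia.
rewrite subr_ge0 ler_pdivrMr // mul1r (le_trans _ h) // ler_nat; lia.
Qed.

Lemma expR_log_gap_qprod (R : realType) (L M a b : nat) :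
  (0 < L)%N -> (0 < M)%N -> (a * M <= L * b.+1)%N -> (b * L <= M * a.+1)%N ->
  (2 * (a + b).+1 <= L + M)%N ->
  expR (log_gap L%:R M%:R a%:R b%:R : R) * (qprod L%:R a * qprod M%:R b)
    <= qprod (L%:R + M%:R - 1) (a + b).
Proof.
have [k] := ubnP (a + b); elim: k L M a b => // k IH.
(* Removes the last factor of the first product; the other case follows by exchanging [(L, a)] with
   [(M, b)]. *)
have step L M a b : (a + b < k)%N -> (0 < L)%N -> (0 < M)%N ->
  (a * M <= L * b.+1)%N -> (b * L <= M * a.+1)%N ->
  (2 * (a.+1 + b).+1 <= L + M)%N -> (a.+1 <= L)%N -> (b <= M)%N ->
  expR (log_gap L%:R M%:R a.+1%:R b%:R : R) * (qprod L%:R a.+1 * qprod M%:R b)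
    <= qprod (L%:R + M%:R - 1) (a.+1 + b).
  move=> hk L0 M0 h1 h2 h3 h4 h5.
  have := IH L M a b hk L0 M0 h1 h2 ltac:(lia).
  have [h1R h2R h3R] : [/\ a%:R * M%:R <= L%:R * (b%:R + 1) :> R,
    b%:R * L%:R <= M%:R * (a%:R + 1) :> R & 2 * (a%:R + b%:R + 2) <= L%:R + M%:R :> R].
    split; [by rewrite natr1 -!natrM ler_nat | by rewrite natr1 -!natrM ler_nat |].
    by rewrite -!natrD -natrM ler_nat; lia.
  have L0R : 0 < L%:R :> R by rewrite ltr0n.
  have M0R : 0 < M%:R :> R by rewrite ltr0n.
  have := @log_gap_step R L%:R M%:R a%:R b%:R L0R M0R (ler0n _ _) (ler0n _ _) h1R h2R h3R.
  have Q0 : 0 <= qprod (L%:R : R) a * qprod M%:R b.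
    by rewrite mulr_ge0 // qprod_ge0 // ler_nat; lia.
  rewrite addSn !qprodS -[(a + b).+1%:R]natr1 natrD -[a.+1%:R]natr1.
  have a0 : 0 <= a%:R :> R by [].
  have b0 : 0 <= b%:R :> R by [].
  have hL : a%:R + 1 <= L%:R :> R by rewrite natr1 ler_nat.
  move: (qprod _ a) (qprod _ b) (qprod _ (a + b)) Q0 => p q r Q0.
  move: (a%:R : R) (b%:R : R) (L%:R : R) (M%:R : R) a0 b0 hL L0R M0R h3R
    => x y l m x0 y0 xl l0 m0 h3R {h1R h2R} hs hr.
  set e0 := log_gap l m x y in hs hr; set e1 := log_gap l m (x + 1) y in hs *.
  set K := l + m - 1 in hs *; set t := (x + 1) / l in hs *.
  have K1 : 0 < K - (x + y + 1) by rewrite /K; lra.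
  have K0 : 0 < K by lra.
  set s := (x + y + 1) / K.
  have s1 : 0 < 1 - s.
    by rewrite /s -{1}(divff (lt0r_neq0 K0)) -mulrBl divr_gt0.
  have t1 : 0 <= 1 - t by rewrite subr_ge0 /t ler_pdivrMr // mul1r.
  have es : expR (e1 - e0) * (1 - t) <= 1 - s.
    set eta := _ / _ in hs.
    have E : 1 - t = (1 - s) * (1 - eta).
      by rewrite /eta /s /t; field; rewrite !lt0r_neq0.
    rewrite E mulrCA -{2}[1 - s]mulr1 ler_pM2l //.
    have := expR_ge1Dx (- eta) => h.
    apply: (@le_trans _ _ (expR (e1 - e0) * expR (- eta))).
      by rewrite ler_pM2l ?expR_gt0.
    by rewrite -expRD expR_le1 subr_le0.
  have -> : expR e1 * (p * (1 - t) * q) = (expR e0 * (p * q)) * (expR (e1 - e0) * (1 - t)).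
    by rewrite -{1}(subrK e0 e1) expRD; ring.
  apply: ler_pM => //.
  - by rewrite mulr_ge0 // expR_ge0.
  - by rewrite mulr_ge0 // expR_ge0.
move=> L M a b hk L0 M0 h1 h2 h3.
(* Adding [a * L] to [h1] gives [a * (L + M) <= L * (a + b + 1)], and [h3] bounds the right side by
   [L * (L + M) / 2]; likewise for [b]. *)
have [h4 h5] : (2 * a <= L)%N /\ (2 * b <= M)%N by split; nia.
have [ab0|ab0] := posnP (a + b).
  have [-> ->] : a = 0 /\ b = 0 by lia.
  rewrite /qprod !big_ord0 !mulr1 /log_gap !(mulr0n, add0r, mul0r, subr0, oppr0).
  by rewrite expR0.
(* The sign of [a * M - b * L] decides which index to lower: [b * L <= a * M] is exactly the second
   region inequality at [(a - 1, b)]. *)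
have [d0|d0] := leqP (b * L) (a * M).
  case: a => [|a] in h1 h2 h3 h4 hk ab0 d0 *; first nia.
  apply: step => //; nia.
case: b => [|b] in h1 h2 h3 h5 hk ab0 d0 *; first nia.
rewrite log_gapC [X in _ * X]mulrC addnC [L%:R + _]addrC.
apply: step => //; nia.
Qed.

(** * Falling factorials against powers *)

Lemma ffact_qprod (R : realFieldType) (L a : nat) :
  (L.+1%:R : R) ^+ a * qprod L.+1%:R a = (L ^_ a)%:R.
Proof.
elim: a => [|a IH]; first by rewrite /qprod big_ord0 mulr1 ffactn0.
rewrite qprodS ffactnSr natrM exprSr mulrACA IH.
have [aL|La] := leqP a L; last by rewrite ffact_small // !mul0r.
rewrite natrB // -!natr1; field.
by rewrite natr1 pnatr_eq0.
Qed.

(** Each factor [(M - i) / (M + e)] is nondecreasing in [M]. The shift [e] is 1 when the leading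
    factor of a falling factorial has been split off, and 0 otherwise. *)
Lemma ffact_pow_mono (b e M K : nat) : (M <= K)%N ->
  (M ^_ b * (K + e) ^ b <= (M + e) ^ b * K ^_ b)%N.
Proof.
move=> MK; elim: b => // b IH.
rewrite !ffactnSr !expnSr mulnACA [X in (_ <= X)%N]mulnACA; apply: leq_mul => //.
have [bM|/ltnW/eqP ->] := leqP b M; last by rewrite mul0n.
rewrite mulnDr mulnDl; apply: leq_add; last by rewrite mulnC leq_mul2l leq_sub2r ?orbT.
by rewrite mulnBl mulnBr leq_sub2l // [(M * b)%N]mulnC leq_mul2l MK orbT.
Qed.

(* R only hosts the real-number argument. *)
Lemma ffact_pow_inner (R : realType) (L M a b : nat) :
  (2 * (a + b).+1 <= L.+1 + M.+1)%N ->
  (L ^_ a * M ^_ b * (L + M).+1 ^ (a + b) <= L.+1 ^ a * M.+1 ^ b * (L + M) ^_ (a + b))%N.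
Proof.
(* The two region inequalities cannot both fail, so exchanging the roles of [L] and [M] secures the
   first one. *)
wlog ab : L M a b / (a * M.+1 <= L.+1 * b.+1)%N => [hw h|].
  have [|] := leqP (a * M.+1) (L.+1 * b.+1); first by move=> ab; apply: hw.
  move=> ab; rewrite [(L ^_ a * _)%N]mulnC [(L.+1 ^ a * _)%N]mulnC [(L + M)%N]addnC [(a + b)%N]addnC.
  apply: hw; nia.
have [k] := ubnP b; elim: k a b ab => // k IH a b ab bk h.
(* Outside the region, (a, b) is moved to (a + 1, b - 1), which increases the
   left-hand side and preserves a M <= L (b + 1). *)
have [dM|dM] := ltnP (M.+1 * a.+1) (b * L.+1).
  case: b => [|b] in ab bk dM h *; first by lia.
  (* Trading the factor [(M - b) / M.+1] for [(L - a) / L.+1] does not decrease the product; this is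
     [dM] subtracted from [M.+1 * L.+1]. *)
  have h1 : ((M - b) * L.+1 <= M.+1 * (L - a))%N.
    have -> : (M - b = M.+1 - b.+1)%N by lia.
    have -> : (L - a = L.+1 - a.+1)%N by lia.
    by rewrite mulnBl mulnBr leq_sub2l // ltnW.
  have h2 := IH a.+1 b ltac:(nia) ltac:(lia) ltac:(lia).
  rewrite -(leq_pmul2l (ltn0Sn L)) -addSnnS.
  apply: (@leq_trans (M.+1 * (L ^_ a.+1 * M ^_ b * (L + M).+1 ^ (a.+1 + b)))%N).
    rewrite !ffactnSr; move: (L ^_ a) (M ^_ b) (_ ^ _)%N => x y z.
    by move/(leq_mul (leqnn (x * y * z))): h1; congr (_ <= _)%N; ring.
  move/(leq_mul (leqnn M.+1)): h2 => /leq_trans; apply.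
  rewrite !expnS; apply: eq_leq; ring.
have [->|a0] := posnP a.
  rewrite !ffactn0 !expn0 !mul1n add0n.
  by have := @ffact_pow_mono b 1 M (L + M) (leq_addl _ _); rewrite !addn1.
have [->|b0] := posnP b.
  rewrite !ffactn0 !expn0 !muln1 addn0.
  by have := @ffact_pow_mono a 1 L (L + M) (leq_addr _ _); rewrite !addn1.
rewrite -(ler_nat R) !natrM !natrX -!ffact_qprod.
have e0 : 0 <= log_gap (L.+1%:R : R) M.+1%:R a%:R b%:R.
  apply: log_gap_ge0; rewrite ?ler1n ?ler_nat //; try nia.
  by rewrite -natrD natr1 -natrD -natrM ler_nat; lia.
have := @expR_log_gap_qprod R L.+1 M.+1 a b isT isT ab dM h.
have -> : L.+1%:R + M.+1%:R - 1 = (L + M).+1%:R :> R.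
  by rewrite -natrD addnS addSn -natr1 addrK.
move=> hq.
have hp : qprod L.+1%:R a * qprod M.+1%:R b <= qprod (L + M).+1%:R (a + b) :> R.
  apply: le_trans hq; rewrite ler_peMl //.
    by rewrite mulr_ge0 // qprod_ge0 // ler_nat; nia.
  by apply: le_trans (expR_ge1Dx _); rewrite lerDl.
move: hp; set p := qprod _ a; set q := qprod _ b; set r := qprod _ _ => hp.
have -> : L.+1%:R ^+ a * p * (M.+1%:R ^+ b * q) * (L + M).+1%:R ^+ (a + b)
  = (L.+1%:R ^+ a * M.+1%:R ^+ b * (L + M).+1%:R ^+ (a + b)) * (p * q) by ring.
by rewrite !mulrA -mulrA ler_wpM2l // ?mulr_ge0 // exprn_ge0.
Qed.

(** For [k] and [l] positive, splitting off the leading factors [L], [M] and [(L + M).-1] leaves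
    [ffact_pow_inner]; if one of them is 0, monotonicity suffices. *)
Lemma ffact_pow_le (R : realType) (L M k l n : nat) :
  (k + l = n.+1)%N -> (2 * n <= L + M)%N ->
  (L ^_ k * M ^_ l * (L + M).-1 ^ n <= L ^ k * M ^ l * (L + M).-1 ^_ n)%N.
Proof.
have edge L' M' : (M' ^_ n.+1 * (L' + M').-1 ^ n <= M' ^ n.+1 * (L' + M').-1 ^_ n)%N.
  (* Monotonicity needs [M' <= (L' + M').-1], which holds for positive [L']. For [L' = 0] the
     leading factor cancels and only a comparison of powers of [M'.-1] and [M'] is left. *)
  case: L' => [|L']; last first.
    rewrite addSn /= ffactnSr expnSr mulnAC [X in (_ <= X)%N]mulnAC leq_mul ?leq_subr //.
    by have := @ffact_pow_mono n 0 M' (L' + M') (leq_addl _ _); rewrite !addn0.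
  rewrite add0n; case: M' => [|M'] //.
  rewrite ffactSS /= expnS -!mulnA leq_mul2l /= mulnC leq_mul2r.
  by case: n => // n; rewrite leq_exp2r // leqnSn orbT.
case: k => [|a]; first by rewrite add0n => -> _; rewrite ffactn0 expn0 !mul1n edge.
case: l => [|b].
  rewrite addn0 => -> _; rewrite ffactn0 expn0 !muln1.
  by rewrite [(L + M)%N]addnC edge.
move=> E h; have -> : n = (a + b).+1 by lia.
case: L h => [|L] //; case: M => [|M] h; first by rewrite ffact0n muln0.
have := @ffact_pow_inner R L M a b ltac:(lia).
rewrite addSn addnS /= !ffactSS !expnS => /(leq_mul (leqnn (L.+1 * M.+1 * (L + M).+1))).
by congr (_ <= _)%N; ring.
Qed.

(** * Comparison of the hypergeometric and binomial weights *)

Lemma one_sub_inv_expE (R : realFieldType) (N n : nat) : (0 < N)%N ->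
  (1 - 1 / N%:R : R) ^+ n = (N.-1 ^ n)%:R / (N ^ n)%:R.
Proof.
case: N => // N _; rewrite /= !natrX -expr_div_n; congr (_ ^+ n).
by rewrite -natr1; field; rewrite natr1 pnatr_eq0.
Qed.

(** Brings the weight to the shape of [binE], with the same factor ['C(n, k)], so that only falling
    factorials and powers remain to be compared. *)
Lemma hypE (R : realType) (N L n : nat) (k : 'I_n.+1) : (n <= N)%N ->
  hyp N L n k = 'C(n, k)%:R * (L ^_ k * (N - L) ^_ (n - k))%:R / (N ^_ n)%:R :> R.
Proof.
move=> nN; have kn : (k <= n)%N by rewrite -ltnS.
have fn0 m : (m`!)%:R != 0 :> R by rewrite pnatr_eq0 -lt0n fact_gt0.
have c0 m p : (p <= m)%N -> ('C(m, p))%:R != 0 :> R.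
  by rewrite pnatr_eq0 -lt0n bin_gt0.
rewrite /hyp -!bin_ffact !natrM.
have := congr1 (fun i => i%:R : R) (bin_fact kn); rewrite !natrM => <-.
by field; rewrite !fn0 !c0.
Qed.

Lemma binE (R : realType) (N L n : nat) (k : 'I_n.+1) : (L <= N)%N -> (0 < N)%N ->
  bin n (L%:R / N%:R) k = 'C(n, k)%:R * (L ^ k * (N - L) ^ (n - k))%:R / (N ^ n)%:R :> R.
Proof.
move=> LN N0; have kn : (k <= n)%N by rewrite -ltnS.
have n0 : N%:R != 0 :> R by rewrite pnatr_eq0 -lt0n.
have -> : (N ^ n = N ^ k * N ^ (n - k))%N by rewrite -expnD subnKC.
have q : 1 - L%:R / N%:R = (N - L)%:R / N%:R :> R by rewrite natrB // mulrBl divff.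
rewrite /bin q !natrM !natrX !expr_div_n.
by field; rewrite !expf_neq0.
Qed.

Lemma sum_hyp (R : realType) (N L n : nat) : (L <= N)%N -> (n <= N)%N ->
  \sum_(k < n.+1) hyp N L n k = 1 :> R.
Proof.
move=> LN nN; rewrite /hyp -mulr_suml.
under eq_bigr do rewrite -natrM.
by rewrite -natr_sum binomial.Vandermonde subnKC // divff // pnatr_eq0 -lt0n bin_gt0.
Qed.

Lemma sum_bin (R : realType) (n : nat) (p : R) : \sum_(k < n.+1) bin n p k = 1.
Proof.
have := exprDn (1 - p) p n; rewrite subrK expr1n => ->.
by apply: eq_bigr => k _; rewrite /bin -mulrA mulr_natl [X in X *+ _]mulrC.
Qed.

Lemma hyp_ge0 (R : realType) (N L n : nat) (k : 'I_n.+1) : 0 <= hyp N L n k :> R.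
Proof. by rewrite /hyp divr_ge0 // mulr_ge0. Qed.

Lemma hyp_le_bin (R : realType) (N L n : nat) (k : 'I_n.+2) :
  (L <= N)%N -> (n < N)%N -> (2 * n <= N)%N ->
  (1 - 1 / N%:R) ^+ n * hyp N L n.+1 k <= bin n.+1 (L%:R / N%:R) k :> R.
Proof.
move=> LN nN h; have N0 : (0 < N)%N by lia.
have kn : (k + (n.+1 - k) = n.+1)%N by rewrite subnKC // -ltnS.
have := @ffact_pow_le R L (N - L) k (n.+1 - k) n kn; rewrite subnKC // => /(_ h) hh.
rewrite one_sub_inv_expE // hypE // binE //.
case: N N0 nN LN h hh => // N _ nN LN h; rewrite /= ffactSS expnS.
move: (L ^_ k * _)%N (L ^ k * _)%N => X Y.
have p0 : 0 < (N ^_ n)%:R :> R by rewrite ltr0n ffact_gt0 -ltnS.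
have q0 : 0 < (N.+1 ^ n)%:R :> R by rewrite ltr0n expn_gt0.
have n0 : 0 < N.+1%:R :> R by rewrite ltr0n.
rewrite -(ler_nat R) !natrM => hh.
have C0 : 0 <= 'C(n.+1, k)%:R :> R by [].
move: (N ^ n)%:R (N.+1 ^ n)%:R (N ^_ n)%:R N.+1%:R X%:R Y%:R 'C(n.+1, k)%:R p0 q0 n0 hh C0.
move=> A B D z x y C D0 B0 z0 hh C0.
rewrite (_ : A / B * _ = C / (z * B * D) * (x * A)); last by field; rewrite !lt0r_neq0.
rewrite (_ : C * _ / _ = C / (z * B * D) * (y * D)); last by field; rewrite !lt0r_neq0.
by rewrite ler_wpM2l // divr_ge0 // ?mulr_ge0 // ltW.
Qed.

(** The index [lift ord0 ord0] is [k = 1]: for [L = 1] the pointwise bound is attained there, which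
    makes the constant in [rho] sharp. *)
Lemma hyp1_bin (R : realType) (N n : nat) : (n < N)%N ->
  (1 - 1 / N%:R) ^+ n * hyp N 1 n.+1 (lift ord0 ord0) = bin n.+1 (1 / N%:R) (lift ord0 ord0) :> R.
Proof.
move=> nN; have N0 : (0 < N)%N by lia.
rewrite one_sub_inv_expE // hypE // (@binE R N 1) // /= !expn1 ffactn1 !mul1n !subn1 /=.
case: N N0 nN => // N _ nN; rewrite /= ffactSS expnS !natrM.
have p0 : (N ^_ n)%:R != 0 :> R by rewrite pnatr_eq0 -lt0n ffact_gt0 -ltnS.
have q0 : (N.+1 ^ n)%:R != 0 :> R by rewrite pnatr_eq0 expn_eq0.
have z0 : N.+1%:R != 0 :> R by rewrite pnatr_eq0.
move: (N ^_ n)%:R (N.+1 ^ n)%:R N.+1%:R p0 q0 z0 => x y z x0 y0 z0.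
by field; rewrite x0 y0 z0.
Qed.

Lemma hyp_ord0_le_bin (R : realType) (N L n : nat) : (L <= N)%N -> (n < N)%N ->
  hyp N L n.+1 ord0 <= bin n.+1 (L%:R / N%:R) ord0 :> R.
Proof.
move=> LN nN; have N0 : (0 < N)%N by lia.
rewrite hypE // binE // bin0 ffactn0 expn0 !mul1n !mul1r subn0.
rewrite ler_pdivrMr ?ltr0n ?ffact_gt0 // mulrAC ler_pdivlMr ?ltr0n ?expn_gt0 ?N0 //.
rewrite -!natrM ler_nat; have := @ffact_pow_mono n.+1 0 (N - L) N (leq_subr _ _).
by rewrite !addn0.
Qed.

Lemma hyp_ord_max_le_bin (R : realType) (N L n : nat) : (L <= N)%N -> (n < N)%N ->
  hyp N L n.+1 ord_max <= bin n.+1 (L%:R / N%:R) ord_max :> R.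
Proof.
move=> LN nN; have N0 : (0 < N)%N by lia.
rewrite hypE // binE // binn subnn ffactn0 expn0 !muln1 !mul1r.
rewrite ler_pdivrMr ?ltr0n ?ffact_gt0 // mulrAC ler_pdivlMr ?ltr0n ?expn_gt0 ?N0 //.
rewrite -!natrM ler_nat; have := @ffact_pow_mono n.+1 0 L N LN.
by rewrite !addn0.
Qed.

Lemma ffact_natr (R : realType) (m n : nat) : ffact (m%:R : R) n = (m ^_ n)%:R.
Proof.
elim: n => [|n IH]; first by rewrite /ffact big_ord0 ffactn0.
rewrite /ffact big_ord_recr -/(ffact _ n) IH ffactnSr natrM /=.
have [nm|mn] := leqP n m; first by rewrite natrB.
by rewrite ffact_small // !mul0r.
Qed.

Lemma bernoulli (R : realFieldType) (x : R) (n : nat) : 0 <= x <= 1 ->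
  1 - n%:R * x <= (1 - x) ^+ n.
Proof.
move=> /andP[x0 x1]; elim: n => [|n IH]; first by rewrite mul0r subr0.
rewrite exprS -natr1.
apply: (@le_trans _ _ ((1 - x) * (1 - n%:R * x))).
  have : 0 <= n%:R * x * x by rewrite !mulr_ge0.
  by lra.
by rewrite ler_wpM2l // subr_ge0.
Qed.

(** * From weights to events *)

(** Passing to the complement of [A] changes the sign of the difference, so a one-sided bound over
    all events is enough. *)
Lemma dTV_le (R : realType) (n : nat) (Q P : 'I_n.+1 -> R) (t : R) :
  \sum_k Q k = 1 -> \sum_k P k = 1 ->
  (forall A : {set 'I_n.+1}, prob Q A - prob P A <= t) -> dTV Q P <= t.
Proof.
move=> Q1 P1 h; apply: bigmax_le => [|A _].
  by have := h set0; rewrite /prob !big_set0 subrr.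
rewrite ler_norml h andbT lerNl opprB.
have probC F : \sum_k F k = 1 -> prob F A = 1 - prob F (~: A).
  move=> <-; rewrite /prob [X in X - _](bigID (fun k => k \in A)) /=.
  rewrite [X in _ + X - _](eq_bigl (fun k => k \in ~: A)) ?addrK // => k.
  by rewrite in_setC.
by rewrite !probC //; have := h (~: A); lra.
Qed.

Lemma rho_le (R : realType) (n : nat) (Q P : 'I_n.+1 -> R) (r : R) :
  0 < r -> (forall k, 0 <= Q k) -> (forall k, r * Q k <= P k) ->
  (rho Q P <= (r^-1)%:E)%E.
Proof.
move=> r0 Q0 QP; apply: bigmax_le => [|A _]; first by rewrite lee_fin invr_ge0 ltW.
have QA : 0 <= prob Q A by apply: sumr_ge0.
have QPA : r * prob Q A <= prob P A by rewrite /prob mulr_sumr; apply: ler_sum.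
rewrite /Defs.ratio; have [PA|PA] := eqVneq (prob P A) 0.
  (* A null event of [P] is null for [Q], which excludes the value [+oo]. *)
  have -> : prob Q A = 0.
    by apply/eqP; rewrite eq_le QA -(ler_pM2l r0) mulr0 -PA QPA.
  by rewrite eqxx lee_fin invr_ge0 ltW.
have PA0 : 0 < prob P A.
  by rewrite lt_neqAle eq_sym PA (le_trans _ QPA) // mulr_ge0 // ltW.
by rewrite lee_fin ler_pdivrMr // mulrC ler_pdivlMr // mulrC.
Qed.

Theorem theorem2 (R : realType) (N L n : nat) :
  (1 <= n)%N -> (n <= N)%N -> (n%:R - 1 <= N%:R / 2 :> R) -> (L <= N)%N ->
  let c : R := 1 - ffact (L%:R : R) n / ffact (N%:R : R) n
                 - ffact ((N - L)%:R : R) n / ffact (N%:R : R) n in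
  [/\ (rho (@hyp R N L n) (bin n (L%:R / N%:R))
         <= rho (@hyp R N 1 n) (bin n (1 / N%:R)))%E,
      rho (@hyp R N 1 n) (bin n (1 / N%:R)) = ((1 - 1 / N%:R) ^- (n - 1))%:E,
      ((1 - 1 / N%:R) ^- (n - 1) <= (1 - (n - 1)%:R / N%:R)^-1 :> R),
      dTV (@hyp R N L n) (bin n (L%:R / N%:R))
        <= c * (1 - (1 - 1 / N%:R) ^+ (n - 1))
    & c * (1 - (1 - 1 / N%:R) ^+ (n - 1)) <= c * ((n - 1)%:R / N%:R)].
Proof.
case: n => // n _ nN h LN; rewrite subn1 /= !ffact_natr.
set c : R := 1 - _ - _; set r : R := (1 - 1 / N%:R) ^+ n.
have N0 : (0 < N)%N by lia.
have N0R : 0 < N%:R :> R by rewrite ltr0n.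
have h2 : (2 * n <= N)%N.
  by rewrite -(ler_nat R) natrM; move: h; rewrite -natr1; lra.
(* For [N = 1] the base vanishes, but then the exponent [n] is 0 and [r = 1]. *)
have r0 : 0 < r.
  rewrite /r one_sub_inv_expE // divr_gt0 // ltr0n expn_gt0 ?N0 //.
  by case: N N0 nN {c r N0R h LN h2} => [|[|N]] // _; case: n.
have iN : 0 <= (1 / N%:R : R) <= 1.
  by rewrite divr_ge0 //= ler_pdivrMr // mul1r ler1n.
have rB : 1 - n%:R / N%:R <= r.
  by have := bernoulli R _ n iN; rewrite [n%:R * _]mulrA mulr1.
have r1 : r <= 1 by rewrite exprn_ile1 //; lra.
have cE : c = 1 - hyp N L n.+1 ord0 - hyp N L n.+1 ord_max.
  rewrite !hypE // bin0 binn subn0 subnn !ffactn0 mul1n muln1 !mul1r.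
  by rewrite /c addrAC.
have cS : c = \sum_(k | (k != ord0) && (k != ord_max)) hyp N L n.+1 k.
  rewrite cE -(sum_hyp R N L n.+1) // (bigD1 ord0) //= (bigD1 ord_max) //=.
  ring.
have rhoE : rho (@hyp R N 1 n.+1) (bin n.+1 (1 / N%:R)) = (r^-1)%:E.
  apply/le_anti/andP; split.
    apply: rho_le => // k; first exact: hyp_ge0.
    exact: (@hyp_le_bin R N 1).
  have k0 : 0 < hyp N 1 n.+1 (lift ord0 ord0 : 'I_n.+2) :> R.
    rewrite /hyp /= bin1 subSS subn0 subn1 mul1r divr_gt0 // ltr0n bin_gt0 //.
    by lia.
  (* The event [{1}] witnesses the lower bound, its ratio being exactly [r^-1]. *)
  apply: le_trans (le_bigmax _ _ [set lift ord0 ord0]).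
  rewrite /Defs.ratio /prob !big_set1 -hyp1_bin // -/r mulf_eq0 !gt_eqF //=.
  by rewrite invfM mulrCA divff ?mulr1 ?gt_eqF.
split.
- rewrite rhoE; apply: rho_le => // k; first exact: hyp_ge0.
  exact: hyp_le_bin.
- exact: rhoE.
- by rewrite lef_pV2 ?posrE // subr_gt0 ltr_pdivrMr // mul1r ltr_nat.
- apply: dTV_le; [exact: sum_hyp | exact: sum_bin | move=> A].
  (* Both sums are extended by zeros to all [k] and compared termwise: the endpoint differences are
     at most 0, and inner ones at most [(1 - r)] times the hypergeometric weight. *)
  rewrite /prob -sumrB cS mulr_suml [leRHS]big_mkcond /= big_mkcond /=.
  apply: ler_sum => k _.
  have hk := hyp_ge0 R N L n.+1 k.
  have pos : 0 <= hyp N L n.+1 k * (1 - r) by rewrite mulr_ge0 // subr_ge0.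
  have [->|k0] := eqVneq k ord0.
    by case: ifP => //= _; rewrite subr_le0 hyp_ord0_le_bin.
  have [->|k1] := eqVneq k ord_max.
    by case: ifP => //= _; rewrite subr_le0 hyp_ord_max_le_bin.
  case: ifP => //= _.
  by have := @hyp_le_bin R N L n k LN nN h2; rewrite -/r; lra.
- rewrite ler_wpM2l //; last by lra.
  by rewrite cS sumr_ge0 // => k _; exact: hyp_ge0.
Qed.
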